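(* Let $l\ge 1$ be an integer and let $f,g,h\in\mathbb{C}[x]$ be non-constant complex polynomials such that $f(x)=g(h(x))$ and $f$ has at most $l$ non-constant terms, i.e. $f(x)=a_0+a_1x^{n_1}+\cdots+a_lx^{n_l}$ for some $a_i\in\mathbb{C}$ and integers $0<n_1<\cdots<n_l$. Then there exist polynomials $P,Q\in\mathbb{C}[x]$, $Q\neq 0$, each having at most $$B_1(l)=(4l)^{(2l)^{(3l)^{l+1}}}$$ terms, such that $h(x)=P(x)/Q(x)$.
   Context: The number of terms of a polynomial is the number of its nonzero coefficients (monomials with nonzero coefficient). Only the number of terms of $f$ is fixed; its coefficients and degrees are arbitrary. *)

(* Defs.v *)
From mathcomp Require Import all_boot all_order all_algebra.
From mathcomp Require Import reals complex.

Set Implicit Arguments.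
Unset Strict Implicit.
Unset Printing Implicit Defensive.

Import GRing.Theory Num.Theory.
Local Open Scope ring_scope.

Definition nterms (R : nzRingType) (p : {poly R}) : nat :=
  count (fun c => c != 0) p.

Definition B1 (l : nat) : nat :=
  ((4 * l) ^ ((2 * l) ^ ((3 * l) ^ (l + 1))))%N.

(* Main.v *)
(* Schinzel's conjecture, after Zannier, by expansion at infinity.  With [u = 1/x],
   [n = deg f], [m = deg g], [d = deg h], removing the constant that kills the
   coefficient of degree [m - 1] of [g] makes the reversed polynomials satisfy
   [H^m = p mod u^(2d)].  By pigeonhole on scales, write [p = A + R], where the
   exponents of [A] are tiny and those of [R] are large compared with [d]; then
   [A^k H = A^(1/m) S mod u^(2d)], with [S] obtained by truncating the binomial
   series of [(A + R)^(1/m)], hence with few terms.  A product of Euler operators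
   [u d/du - e], conjugated by [A^(1/m)], kills the right-hand side modulo
   [u^(2d)], and maps [A^k H] to a polynomial of degree less than [2d], which is
   therefore zero.  So [A^k H = A^(1/m) S'] exactly, with [S'] having the same
   possible exponents as [S]; thus [A = B^m] is a perfect power, [A] has fewer
   terms than [f], and induction applies to [B]. *)
Require Import Defs.
From mathcomp Require Import all_boot all_order all_algebra.
From mathcomp Require Import reals complex.
From mathcomp Require Import zify ring.

Set Implicit Arguments.
Unset Strict Implicit.
Unset Printing Implicit Defensive.

Import GRing.Theory Num.Theory.
Local Open Scope ring_scope.

(** * Supports and numbers of terms *)

Section Support.
Variable F : fieldType.
Implicit Types (p q : {poly F}) (E : seq nat).

Definition supported E p := forall i, i \notin E -> p`_i = 0.

Definition supp p := [seq i <- iota 0 (size p) | p`_i != 0].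

Lemma mem_supp p i : (i \in supp p) = (p`_i != 0).
Proof.
rewrite mem_filter mem_iota add0n /=; case: ltnP => [|le_p_i]; first by rewrite andbT.
by rewrite andbF nth_default ?eqxx.
Qed.

Lemma supported_supp p : supported (supp p) p.
Proof. by move=> i; rewrite mem_supp negbK => /eqP. Qed.

Lemma size_supp p : size (supp p) = nterms p.
Proof.
rewrite size_filter /nterms -[in RHS](mkseq_nth 0 p) /mkseq count_map.
by apply: eq_count.
Qed.

Lemma nterms_supported E p : supported E p -> (nterms p <= size E)%N.
Proof.
move=> suppE; rewrite -size_supp; apply: uniq_leq_size.
  by rewrite filter_uniq ?iota_uniq.
by move=> i; rewrite mem_supp; apply: contraR => /suppE ->.
Qed.

Lemma supportedD E1 E2 p q :
  supported E1 p -> supported E2 q -> supported (E1 ++ E2) (p + q).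
Proof.
by move=> sp sq i; rewrite mem_cat negb_or coefD => /andP[/sp-> /sq->]; rewrite addr0.
Qed.

Lemma supported_sum E (I : Type) (r : seq I) (P : pred I) (f : I -> {poly F}) :
  (forall i, P i -> supported E (f i)) -> supported E (\sum_(i <- r | P i) f i).
Proof. by move=> sf j jE; rewrite coef_sum big1 // => i Pi; apply: sf. Qed.

Lemma supportedZ E c p : supported E p -> supported E (c *: p).
Proof. by move=> sp i /sp pi; rewrite coefZ pi mulr0. Qed.

Lemma supportedM (E1 E2 E : seq nat) p q :
    (forall i j, i \in E1 -> j \in E2 -> (i + j)%N \in E) ->
  supported E1 p -> supported E2 q -> supported E (p * q).
Proof.
move=> addE sp sq k kE; rewrite coefM big1 // => -[i /=]; rewrite ltnS => le_i_k _.
have [iE|/sp->] := boolP (i \in E1); last by rewrite mul0r.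
have [jE|/sq->] := boolP (k - i \in E2)%N; last by rewrite mulr0.
by move: (addE _ _ iE jE); rewrite subnKC // (negPf kE).
Qed.

Lemma ntermsD p q : (nterms (p + q) <= nterms p + nterms q)%N.
Proof.
rewrite -!size_supp -size_cat size_supp; apply: nterms_supported.
by apply: supportedD; apply: supported_supp.
Qed.

Lemma ntermsZ c p : (nterms (c *: p) <= nterms p)%N.
Proof.
rewrite -[leqRHS]size_supp; apply: nterms_supported.
by apply: supportedZ; apply: supported_supp.
Qed.

Lemma ntermsM p q : (nterms (p * q) <= nterms p * nterms q)%N.
Proof.
have -> : (nterms p * nterms q = size [seq (i + j)%N | i <- supp p, j <- supp q])%N.
  by rewrite size_allpairs !size_supp.
apply: nterms_supported.
apply: supportedM (@supported_supp p) (@supported_supp q) => i j ip jq.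
by apply/allpairsP; exists (i, j).
Qed.

Lemma nterms1 : nterms (1 : {poly F}) = 1%N.
Proof. by rewrite /nterms polyseq1 /= oner_eq0. Qed.

Lemma ntermsX p k : (nterms (p ^+ k) <= nterms p ^ k)%N.
Proof.
elim: k => [|k IHk]; first by rewrite nterms1.
by rewrite exprS expnS (leq_trans (ntermsM _ _)) // leq_mul.
Qed.

End Support.

(** * Exponent sets of products *)

Fixpoint sumset (ds : seq nat) (j : nat) : seq nat :=
  if ds is d :: ds' then [seq (k * d + e)%N | k <- iota 0 j.+1, e <- sumset ds' j]
  else [:: 0%N].

Lemma size_sumset ds j : size (sumset ds j) = (j.+1 ^ size ds)%N.
Proof.
elim: ds => // d ds IH; rewrite [size _](size_allpairs (fun k e => k * d + e)%N).
by rewrite size_iota IH expnS.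
Qed.

Lemma sumset_consP d ds j x :
  reflect (exists k e, [/\ k <= j, e \in sumset ds j & x = k * d + e])%N
          (x \in sumset (d :: ds) j).
Proof.
have -> : sumset (d :: ds) j
          = [seq (k * d + e)%N | k <- iota 0 j.+1, e <- sumset ds j] by [].
apply: (iffP allpairsP) => [[[k e] [kj eE ->]]|[k [e [kj eE ->]]]].
  by exists k, e; split=> //; move: kj; rewrite mem_iota.
by exists (k, e); split=> //; rewrite mem_iota.
Qed.

Lemma sumset0 ds j : 0%N \in sumset ds j.
Proof. by elim: ds => [|d ds IH] //; apply/sumset_consP; exists 0%N, 0%N. Qed.

Lemma sumsetS ds j e : e \in sumset ds j -> e \in sumset ds j.+1.
Proof.
elim: ds e => // d ds IH _ /sumset_consP[k [e [kj eE ->]]].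
by apply/sumset_consP; exists k, e; split; [lia | apply: IH |].
Qed.

Lemma sumset_add ds j e d :
  d \in 0%N :: ds -> e \in sumset ds j -> (d + e)%N \in sumset ds j.+1.
Proof.
rewrite inE => /predU1P[->|]; first exact: sumsetS.
elim: ds e => // d' ds IH _ dE /sumset_consP[k [e [kj eE ->]]].
move: dE; rewrite inE => /predU1P[->|dE]; apply/sumset_consP.
  by exists k.+1, e; split; [lia | apply: sumsetS | lia].
by exists k, (d + e)%N; split; [lia | apply: IH | lia].
Qed.

(** Each factor contributes [0] or one element of [ds], so every multiplicity stays at most [i + j].
    Letting the multiplicities vary independently is coarse, but the size of the exponent set is
    then an explicit power. *)
Lemma supported_prod_sumset (F : fieldType) (p q : {poly F}) ds i j :
    supported (0%N :: ds) p -> supported (0%N :: ds) q ->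
  supported (sumset ds (i + j)) (p ^+ i * q ^+ j).
Proof.
move=> sp sq; elim: i => [|i IHi].
  rewrite add0n expr0 mul1r; elim: j => [|j IHj].
    move=> i iE; rewrite expr0 coef1; case: i iE => //.
    by rewrite sumset0.
  by rewrite exprS; apply: supportedM sq IHj => d e; apply: sumset_add.
by rewrite exprS -mulrA; apply: supportedM sp IHi => d e; apply: sumset_add.
Qed.

(** * Homogenization and reversal of coefficients *)

Section Homogenization.
Variable F : fieldType.
Implicit Types (a b p q : {poly F}).

(* [b ^ N p(a / b)]; for [a = 1], [b = 'X] this reverses the coefficients of [p]. *)
Definition homog a b N p : {poly F} := \sum_(i < N.+1) p`_i *: (a ^+ i * b ^+ (N - i)).

Lemma homogD a b N p q : homog a b N (p + q) = homog a b N p + homog a b N q.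
Proof. by rewrite -big_split; apply: eq_bigr => i _; rewrite coefD scalerDl. Qed.

Lemma homogZ a b N c p : homog a b N (c *: p) = c *: homog a b N p.
Proof. by rewrite scaler_sumr; apply: eq_bigr => i _; rewrite coefZ scalerA. Qed.

Lemma homogB a b N p q : homog a b N (p - q) = homog a b N p - homog a b N q.
Proof. by rewrite homogD -scaleN1r homogZ scaleN1r. Qed.

Lemma homog0 a b N : homog a b N 0 = 0.
Proof. by have := homogZ a b N 0 0; rewrite !scale0r. Qed.

Lemma homog_sum a b N n (f : 'I_n -> {poly F}) :
  homog a b N (\sum_(i < n) f i) = \sum_(i < n) homog a b N (f i).
Proof.
elim: n f => [|n IHn] f; last by rewrite !big_ord_recr /= homogD IHn.
by rewrite !big_ord0 homog0.
Qed.

Lemma homogXn a b N k : (k <= N)%N -> homog a b N 'X^k = a ^+ k * b ^+ (N - k).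
Proof.
move=> le_k_N; rewrite /homog (bigD1 (Ordinal (le_k_N : (k < N.+1)%N))) //= coefXn eqxx scale1r.
rewrite big1 ?addr0 // => i; rewrite -val_eqE /= coefXn => /negPf->.
by rewrite scale0r.
Qed.

Lemma homogM a b N M p q : (size p <= N.+1)%N -> (size q <= M.+1)%N ->
  homog a b (N + M) (p * q) = homog a b N p * homog a b M q.
Proof.
move=> szp szq.
have expand n (r : {poly F}) : (size r <= n)%N -> r = \sum_(i < n) r`_i *: 'X^i.
  by move=> szr; rewrite -poly_def -{1}(take_poly_id szr).
rewrite {1}(expand _ _ szp) {1}(expand _ _ szq) mulr_suml homog_sum mulr_suml.
apply: eq_bigr => -[i /= lt_i_N] _; rewrite mulr_sumr homog_sum mulr_sumr.
apply: eq_bigr => -[j /= lt_j_M] _.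
rewrite -!(scalerAl, scalerAr) -exprD !homogZ homogXn; last by lia.
have -> : (N + M - (i + j) = (N - i) + (M - j))%N by lia.
rewrite !exprD -!mul_polyC; ring.
Qed.

Lemma homog1 a b N : homog a b N 1 = b ^+ N.
Proof. by have := homogXn a b (leq0n N); rewrite !expr0 subn0 mul1r. Qed.

Lemma homogX a b N p m : (size p <= N.+1)%N -> homog a b (m * N) (p ^+ m) = homog a b N p ^+ m.
Proof.
move=> szp; elim: m => [|m IHm]; first by rewrite mul0n homog1.
rewrite !exprS mulSn homogM ?IHm //.
by apply: leq_trans (size_poly_exp_leq _ _) _; case: (size p) szp => //=; nia.
Qed.

(** Every surviving term carries a factor [a ^+ i] with [i >= k]. This transports congruences modulo
    ['X^k] along the substitution of [a / b]. *)
Lemma dvdp_homog a b N k p : (forall i, (i < k)%N -> p`_i = 0) -> a ^+ k %| homog a b N p.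
Proof.
move=> p0; apply: (big_ind (fun q => a ^+ k %| q)) => [||i _]; first exact: dvdp0.
  by move=> q r; apply: dvdp_add.
have [/p0->|le_k_i] := ltnP i k; first by rewrite scale0r dvdp0.
by rewrite -mul_polyC dvdp_mull // dvdp_mulr // dvdp_exp2l.
Qed.

Lemma coef_rev N p j : (homog 1 'X N p)`_j = if (j <= N)%N then p`_(N - j) else 0.
Proof.
rewrite coef_sum; under eq_bigr do rewrite expr1n mul1r coefZ coefXn.
case: leqP => [le_j_N|lt_N_j]; last first.
  by rewrite big1 // => -[i /= lti] _; case: eqP => [|_]; [lia | rewrite mulr0].
have ltj : (N - j < N.+1)%N by lia.
rewrite (bigD1 (Ordinal ltj)) //= subKn // eqxx mulr1 big1 ?addr0 // => -[i /= lti].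
by rewrite -val_eqE /= => neq; case: eqP => [|_]; [lia | rewrite mulr0].
Qed.

Lemma supported_rev N E p :
  supported E p -> supported [seq (N - e)%N | e <- E] (homog 1 'X N p).
Proof.
move=> sp i iE; rewrite coef_rev; case: leqP => // le_i_N; apply: sp.
by apply: contra iE => /(map_f (subn N)); rewrite subKn.
Qed.

Lemma nterms_rev N p : (nterms (homog 1 'X N p) <= nterms p)%N.
Proof.
rewrite -[leqRHS]size_supp -(size_map (subn N)).
by apply: nterms_supported; apply: supported_rev; apply: supported_supp.
Qed.

End Homogenization.

(** * Roots and inverses modulo powers of ['X] *)

Section Truncation.
Variable F : fieldType.
Hypothesis char0 : [pchar F] =i pred0.
Implicit Types (p q z A S T : {poly F}) (M m : nat).

Lemma natf_eq0 n : (n%:R == 0 :> F) = (n == 0%N).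
Proof. by move/pcharf0P: char0; apply. Qed.

Lemma dvdXnP M p : reflect (forall i, (i < M)%N -> p`_i = 0) ('X^M %| p).
Proof.
rewrite /dvdp -Pdiv.IdomainMonic.take_poly_modp.
apply: (iffP eqP) => [tp0 i lt_i_M|p0].
  by have := congr1 (fun q : {poly F} => q`_i) tp0; rewrite coef_take_poly lt_i_M coef0.
by apply/polyP=> i; rewrite coef_take_poly coef0; case: ltnP => // /p0.
Qed.

Lemma coprimep_Xn M p : p`_0 != 0 -> coprimep 'X^M p.
Proof.
move=> p0; apply: coprimep_expl; rewrite coprimep_sym -['X]subr0 coprimep_XsubC.
by rewrite /root horner_coef0.
Qed.

Lemma dvdXn_small M p : 'X^M %| p -> (size p <= M)%N -> p = 0.
Proof.
move=> Mp szp; apply: contraTeq Mp => /dvdp_leq dvd; apply/negP => /dvd.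
by rewrite size_polyXn ltnNge szp.
Qed.

Lemma coef0X p m : (p ^+ m)`_0 = p`_0 ^+ m.
Proof. by rewrite -!horner_coef0 horner_exp. Qed.

Lemma coef0_sum_exp p q m : p`_0 = 1 -> q`_0 = 1 ->
  (\sum_(i < m) p ^+ (m.-1 - i) * q ^+ i)`_0 = m%:R.
Proof.
move=> p0 q0; rewrite coef_sum (eq_bigr (fun=> 1)) => [|i _].
  by rewrite sumr_const card_ord.
by rewrite coef0M !coef0X p0 q0 !expr1n mulr1.
Qed.

(** Hensel lifting, one coefficient at a time; the linear equation for each new coefficient is
    solvable because [m] is invertible in characteristic zero. *)
Lemma root_mod_Xn m M p : (0 < m)%N -> p`_0 = 1 ->
  exists T : {poly F}, [/\ T`_0 = 1, (size T <= M.+1)%N & 'X^(M.+1) %| T ^+ m - p].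
Proof.
move=> m_gt0 p0; elim: M => [|M [T [T0 szT /dvdpP[r def_r]]]].
  exists 1; rewrite coef1 size_poly1; split=> //; apply/dvdXnP => -[|//] _.
  by rewrite expr1n coefB coef1 p0 subrr.
(* The correction changes [T ^+ m] by [c *: 'X^(M.+1)] times a sum with constant term [m], so [c]
   must solve [c * m + r_0 = 0]. *)
pose c := - r`_0 / m%:R; exists (T + c *: 'X^(M.+1)).
set T' := T + _; have T'0 : T'`_0 = 1 by rewrite coefD coefZ coefXn mulr0 addr0.
split=> //.
  rewrite (leq_trans (size_polyD _ _)) // geq_max (leqW szT).
  by rewrite (leq_trans (size_scale_leq _ _)) // size_polyXn.
have -> : T' ^+ m - p = (T' ^+ m - T ^+ m) + (T ^+ m - p) by ring.
rewrite subrXX def_r addrAC subrr add0r; set s := \sum_(i < _) _.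
have -> : c *: 'X^(M.+1) * s + r * 'X^(M.+1) = (c *: s + r) * 'X^(M.+1).
  by rewrite -!mul_polyC; ring.
rewrite ['X^(M.+2)]exprS dvdp_mul //; apply/(dvdXnP 1) => -[|//] _.
rewrite coefD coefZ coef0_sum_exp // /c divfK ?addNr //.
by rewrite natf_eq0 -lt0n.
Qed.

Lemma inverse_mod_Xn M p : p`_0 = 1 -> exists V, 'X^M %| V * p - 1.
Proof.
(* [V] is the truncated geometric series for [1 / (1 - (1 - p))]. *)
move=> p0; pose V := \sum_(i < M) 1 ^+ (M.-1 - i) * (1 - p) ^+ i : {poly F}.
exists V; have -> : V * p - 1 = - (1 - p) ^+ M.
  have : 1 ^+ M - (1 - p) ^+ M = (1 - (1 - p)) * V := subrXX 1 (1 - p) M.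
  by rewrite expr1n subKr mulrC => <-; ring.
rewrite dvdpNr; apply: dvdp_exp2r; apply/(dvdXnP 1) => -[|//] _.
by rewrite coefB coef1 p0 subrr.
Qed.

(** The cofactor of [p - q] in [p ^+ m - q ^+ m] has constant term [m], hence is a unit modulo
    ['X^M]. *)
Lemma root_unique_mod_Xn m M p q : (0 < m)%N -> p`_0 = 1 -> q`_0 = 1 ->
  'X^M %| p ^+ m - q ^+ m -> 'X^M %| p - q.
Proof.
move=> m_gt0 p0 q0; rewrite subrXX Gauss_dvdpl // coprimep_Xn //.
by rewrite coef0_sum_exp // natf_eq0 -lt0n.
Qed.

(** * Euler operators and their conjugates *)

Definition theta p := 'X * p^`().

Lemma coef_theta p i : (theta p)`_i = p`_i *+ i.
Proof. by rewrite coefXM coef_deriv; case: i. Qed.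

Lemma dvdXn_theta M p : 'X^M %| p -> 'X^M %| theta p.
Proof.
by move=> /dvdXnP p0; apply/dvdXnP => i /p0 pi0; rewrite coef_theta pi0 mul0rn.
Qed.

Lemma thetaM p q : theta (p * q) = theta p * q + p * theta q.
Proof. by rewrite /theta derivM; ring. Qed.

Lemma thetaB p q : theta (p - q) = theta p - theta q.
Proof. by rewrite /theta derivB mulrBr. Qed.

Lemma thetaX p m : theta (p ^+ m) = m%:R *: (p ^+ m.-1 * theta p).
Proof. by rewrite scaler_nat /theta deriv_exp -!mulrnAr; ring. Qed.

Lemma size_theta p : (size (theta p) <= size p)%N.
Proof.
by apply/leq_sizeP => j /leq_sizeP le_j; rewrite coef_theta le_j ?mul0rn.
Qed.

Fixpoint euler (es : seq nat) S :=
  if es is e :: es' then euler es' (theta S - e%:R *: S) else S.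

Lemma coef_euler es S i :
  (euler es S)`_i = S`_i * \prod_(e <- es) (i%:R - e%:R).
Proof.
elim: es S => [|e es IH] S; first by rewrite big_nil mulr1.
rewrite /= IH big_cons coefB coef_theta coefZ mulrA; congr (_ * _).
by rewrite -mulr_natr; ring.
Qed.

Lemma euler_eq0 es S : supported es S -> euler es S = 0.
Proof.
move=> sS; apply/polyP=> i; rewrite coef_euler coef0.
have [ies|/sS->] := boolP (i \in es); last by rewrite mul0r.
by rewrite (big_rem i) //= subrr mul0r mulr0.
Qed.

(** Monomials are eigenvectors, and the eigenvalue, the product of the [i - e], is nonzero off [es]
    in characteristic zero. *)
Lemma coef_euler_eq0 es S i : i \notin es -> (euler es S)`_i = 0 -> S`_i = 0.
Proof.
move=> ies /eqP; rewrite coef_euler mulf_eq0 => /orP[/eqP//|].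
rewrite prodf_seq_eq0 => /hasP[e ees /=]; rewrite subr_eq0 => eq_ie.
suff /eqP eq_i : i == e by rewrite eq_i ees in ies.
have natsub j k : (k <= j)%N -> j%:R = k%:R :> F -> j = k.
  move=> le_kj /eqP; rewrite -subr_eq0 -natrB // natf_eq0; lia.
apply/eqP; case/orP: (leq_total e i) => /natsub; first by apply; apply/eqP.
by move=> eq_ei; apply/esym/eq_ei/esym/eqP.
Qed.

(* If [T ^ m = A] and [z = A ^ k * T * S] then [chain A (k + 1 / m) es z] is
   [A ^ (k + size es) * T * euler es S]: the Euler operators conjugated by a
   fractional power of [A], with the denominators cleared. *)
Fixpoint chain A (c : F) (es : seq nat) z :=
  if es is e :: es' then
    chain A (c + 1) es' (A * theta z - c *: (theta A * z) - e%:R *: (A * z))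
  else z.

Lemma size_chain A c es z : A != 0 ->
  (size (chain A c es z) <= size z + size es * (size A).-1)%N.
Proof.
rewrite -size_poly_gt0 => A0; elim: es c z => [|e es IH] c z; first by rewrite mul0n addn0.
apply: leq_trans (IH _ _) _; rewrite /= mulSn addnA leq_add2r.
have szM (p q : {poly F}) : (size p <= size A)%N -> (size q <= size z)%N ->
    (size (p * q)%R <= size z + (size A).-1)%N.
  by move=> szp szq; apply: leq_trans (size_polyMleq _ _) _; lia.
have szD (p q : {poly F}) n : (size p <= n)%N -> (size q <= n)%N -> (size (p - q)%R <= n)%N.
  by move=> szp szq; rewrite (leq_trans (size_polyD _ _)) // size_polyN geq_max szp.
apply: (szD); first apply: (szD); try apply: leq_trans (size_scale_leq _ _) _.
- by apply: szM; rewrite ?size_theta.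
- by apply: szM; rewrite ?size_theta.
- by apply: szM.
Qed.

(** Modulo ['X^M], [T] satisfies the differential equation of [A^(1/m)], so one operator turns
    [A ^+ k * T * S] into [A ^+ k.+1 * T * (theta S - e%:R *: S)]. Errors stay divisible by ['X^M]
    because [theta] never lowers the order at 0. *)
Lemma chain_euler m M A T S k es z : (0 < m)%N ->
    'X^M %| T ^+ m - A -> 'X^M %| z - A ^+ k * T * S ->
  'X^M %| chain A (k%:R + m%:R^-1) es z - A ^+ (k + size es) * T * euler es S.
Proof.
move=> m_gt0 TA; have m0 : m%:R != 0 :> F by rewrite natf_eq0 -lt0n.
(* The logarithmic derivative of [T ^+ m = A] with denominators cleared: apply [theta] to
   [T ^+ m - A] and multiply by [T]. *)
have TA' : 'X^M %| A * theta T - m%:R^-1 *: (theta A * T).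
  have -> : A * theta T - m%:R^-1 *: (theta A * T) =
      m%:R^-1 *: (theta (T ^+ m - A) * T - m%:R *: ((T ^+ m - A) * theta T)).
    rewrite thetaB thetaX scalerBr scalerA mulVf // scale1r.
    rewrite -[in T ^+ m](prednK m_gt0) exprS -!mul_polyC.
    have := congr1 polyC (mulVf m0); rewrite polyCM.
    set c := (_^-1)%:P; set d := (m%:R)%:P => cd.
    ring: cd.
  rewrite -!mul_polyC; apply: dvdp_mull; apply: dvdp_sub.
    by rewrite dvdp_mulr // dvdXn_theta.
  by rewrite dvdp_mull // dvdp_mulr.
elim: es k z S => [|e es IH] k z S zS; first by rewrite addn0.
rewrite /= addnS -addSn addrAC natr1; apply: IH.
have thetaAX : A * theta (A ^+ k) = k%:R *: (theta A * A ^+ k).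
  rewrite thetaX; case: (k) => [|j]; first by rewrite !scale0r mulr0.
  by rewrite exprS -!mul_polyC; ring.
set w := z - _ in zS.
(* The new error is the operator applied to the old error [w], plus a multiple of the error in
   [TA']. *)
have -> : A * theta z - (k%:R + m%:R^-1) *: (theta A * z) - e%:R *: (A * z)
            - A ^+ k.+1 * T * (theta S - e%:R *: S)
        = A * theta w - (k%:R + m%:R^-1)%:P * theta A * w - e%:R%:P * A * w
            + A ^+ k * S * (A * theta T - m%:R^-1 *: (theta A * T)).
  rewrite /w thetaB !thetaM exprS -!mul_polyC polyCD.
  move: thetaAX; rewrite -mul_polyC => thetaAX; ring: thetaAX.
apply: dvdp_add; last exact: dvdp_mull.
apply: dvdp_sub; last exact: dvdp_mull.
by apply: dvdp_sub; apply: dvdp_mull => //; apply: dvdXn_theta.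
Qed.

(** * From approximate to exact roots *)

Lemma coef0_homog (a b : {poly F}) N p : a`_0 = 0 -> b`_0 = 1 -> (homog a b N p)`_0 = p`_0.
Proof.
move=> a0 b0; rewrite coef_sum big_ord_recl big1 => [|i _].
  by rewrite coefZ coef0M !coef0X a0 b0 !expr1n expr0 !mulr1 addr0.
by rewrite coefZ coef0M coef0X a0 expr0n mul0r mulr0.
Qed.

(** Substitute [R / A] for ['X] in the congruence for [b], the truncated binomial series, and
    multiply by [A ^+ (m * k).+1]. *)
Lemma homog_root_approx m k A (R b : {poly F}) : (0 < m)%N -> (0 < k)%N -> (size b <= k.+1)%N ->
    'X^(k.+1) %| b ^+ m - (1 + 'X) ->
  R ^+ k.+1 %| A * homog R A k b ^+ m - A ^+ (m * k) * (A + R).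
Proof.
move=> m_gt0 k_gt0 szb /dvdXnP b_root.
have mk_gt0 : (0 < m * k)%N by rewrite muln_gt0 m_gt0.
have := dvdp_homog R A (m * k) b_root.
rewrite homogB homogX // homogD homog1 -['X]expr1 homogXn // expr1 subn1 => /(dvdp_mull A).
congr (_ %| _); rewrite -[in A ^+ (m * k)%N](prednK mk_gt0) exprS; ring.
Qed.

Lemma size_supported_leq es S : supported es S -> (size S <= (\max_(e <- es) e).+1)%N.
Proof.
move=> sS; apply/leq_sizeP => j lt_j; apply: sS; apply: contraL lt_j => jes.
by rewrite -leqNgt leq_bigmax_seq.
Qed.

(** Divide [z] by a power series root [T] of [A]: the Euler product annihilates the quotient to high
    order, so its truncation [S] lives on [es]. Then [z ^+ m = A * S ^+ m] exactly, hence [S]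
    divides [z] and the quotient is the required root. *)
Lemma chain_eq0_root m A c es z (Nz : z != 0) : (0 < m)%N -> A`_0 = 1 ->
    c = m%:R^-1 -> chain A c es z = 0 ->
  exists S B, [/\ B ^+ m = A, z = S * B & supported es S].
Proof.
move=> m_gt0 A0 -> chain0.
(* [M] bounds the sizes of both [z ^+ m] and [A * S ^+ m], so their congruence modulo ['X^(M.+1)]
   will be an equality. *)
pose M := (size (z ^+ m) + (size A + m * (\max_(e <- es) e).+1))%N.
have [T [T0 _ TA]] := root_mod_Xn M m_gt0 A0.
have [V VT] := inverse_mod_Xn M.+1 T0.
pose S := take_poly M.+1 (V * z).
have zT : 'X^(M.+1) %| z - A ^+ 0 * T * (V * z).
  have -> : z - A ^+ 0 * T * (V * z) = - z * (V * T - 1) by rewrite expr0; ring.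
  exact: dvdp_mull.
have sS : supported es S.
  move=> i ies; rewrite coef_take_poly; case: ltnP => // lt_i_M.
  have := chain_euler es m_gt0 TA zT; rewrite add0r chain0 sub0r dvdpNr Gauss_dvdpr.
    by move/dvdXnP/(_ i lt_i_M)/coef_euler_eq0; apply.
  by rewrite coprimep_Xn // coef0M coef0X A0 T0 expr1n mulr1 oner_eq0.
have zTS : 'X^(M.+1) %| z - T * S.
  have -> : z - T * S = (z - A ^+ 0 * T * (V * z)) + T * drop_poly M.+1 (V * z) * 'X^(M.+1).
    have := poly_take_drop M.+1 (V * z); rewrite -/S.
    by set D := drop_poly _ _ => <-; rewrite expr0; ring.
  by rewrite dvdp_add // dvdp_mull.
have zS : z ^+ m = A * S ^+ m.
  apply/eqP; rewrite -subr_eq0; apply/eqP; apply: (@dvdXn_small M.+1).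
    have -> : z ^+ m - A * S ^+ m
              = (z ^+ m - (T * S) ^+ m) + S ^+ m * (T ^+ m - A).
      by rewrite exprMn; ring.
    by rewrite dvdp_add // ?dvdp_mull // subrXX dvdp_mulr.
  rewrite (leq_trans (size_polyD _ _)) // size_polyN geq_max; apply/andP; split; first lia.
  rewrite (leq_trans (size_polyMleq _ _)) //.
  have szS : ((size S).-1 * m <= m * (\max_(e <- es) e).+1)%N.
    by rewrite mulnC leq_mul2l (leq_trans (leq_pred _)) ?orbT ?size_supported_leq.
  have := leq_trans (size_poly_exp_leq S m) (szS : (_ < _.+1)%N).
  rewrite -(leq_add2l (size A)) => szSm; rewrite (leq_trans (leq_pred _)) //.
  by rewrite (leq_trans szSm) // /M -!addnS leq_addl.
have Sm0 : S ^+ m != 0.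
  by apply: contra_neq Nz => Sm0; apply/eqP; move/eqP: zS; rewrite Sm0 mulr0 expf_eq0 m_gt0.
have /dvdpP[B zB] : S %| z by rewrite -(dvdp_pexp2r _ _ m_gt0) zS dvdp_mull.
exists S, B; split=> //; last by rewrite zB mulrC.
by apply: (mulIf Sm0); rewrite -exprMn -zB zS.
Qed.

Lemma near_root_factor m d k ds A (R H : {poly F}) : (0 < m)%N -> (0 < k)%N ->
    A`_0 = 1 -> R`_0 = 0 -> H`_0 = 1 ->
    supported (0%N :: ds) A -> supported (0%N :: ds) R ->
    'X^(2 * d) %| H ^+ m - (A + R) -> 'X^(2 * d) %| R ^+ k.+1 ->
    (size H <= d.+1)%N ->
    ((k + k.+1 ^ size ds) * (size A).-1 < d)%N ->
  exists S B, [/\ B ^+ m = A, A ^+ k * H = S * B & supported (sumset ds k) S].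
Proof.
move=> m_gt0 k_gt0 A0 R0 H0 sA sR H_root R_small szH lt_d.
have nz p : p`_0 = 1 -> p != 0.
  by move=> p0; apply: contra_eq_neq p0 => ->; rewrite coef0 eq_sym oner_eq0.
set es := sumset ds k.
have [b [b0 szb b_root]] : exists b : {poly F},
    [/\ b`_0 = 1, (size b <= k.+1)%N & 'X^(k.+1) %| b ^+ m - (1 + 'X)].
  by apply: root_mod_Xn => //; rewrite coefD coef1 coefX addr0.
have S_root := homog_root_approx A R m_gt0 k_gt0 szb b_root.
set S := homog R A k b in S_root.
have S0 : S`_0 = 1 by rewrite coef0_homog.
have sS : supported es S.
  apply: supported_sum => -[i /= lt_i_k] _; apply: supportedZ.
  by have := supported_prod_sumset (i := i) (j := k - i) sR sA; rewrite subnKC.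
have [T [T0 _ TA]] := root_mod_Xn (2 * d) m_gt0 A0.
have {}TA : 'X^(2 * d) %| T ^+ m - A by apply: dvdp_trans TA; rewrite dvdp_exp2l.
set z := A ^+ k * H.
(* Both [z] and [T * S] have constant term 1, so by uniqueness of roots it suffices to compare their
   [m]-th powers. *)
have zTS : 'X^(2 * d) %| z - A ^+ 0 * T * S.
  rewrite expr0 mul1r; apply: (@root_unique_mod_Xn m) => //.
  - by rewrite coef0M coef0X A0 H0 expr1n mulr1.
  - by rewrite coef0M T0 S0 mulr1.
  have -> : z ^+ m - (T * S) ^+ m = A ^+ (m * k) * (H ^+ m - (A + R))
      - (A * S ^+ m - A ^+ (m * k) * (A + R)) - S ^+ m * (T ^+ m - A).
    by rewrite /z !exprMn -exprM mulnC; ring.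
  apply: dvdp_sub; last exact: dvdp_mull.
  by apply: dvdp_sub; [apply: dvdp_mull | apply: dvdp_trans S_root].
apply: (@chain_eq0_root m A (0%:R + m%:R^-1)) => //; rewrite ?add0r //.
  by rewrite mulf_neq0 ?expf_neq0 // nz.
(* The chain is divisible by ['X^(2 * d)] since [euler es S = 0], while its size is at most [d + 1]
   plus [(k + k.+1 ^ size ds) * (size A).-1], that is, at most [2 * d]. *)
apply: (@dvdXn_small (2 * d)).
  have := chain_euler es m_gt0 TA zTS.
  by rewrite (euler_eq0 sS) mulr0 subr0 add0r.
apply: leq_trans (size_chain _ _ _ (nz _ A0)) _; rewrite size_sumset.
have := size_polyMleq (A ^+ k) H; have := size_poly_exp_leq A k.
by rewrite -/z; move: lt_d szH; set e := (_ ^ _)%N; nia.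
Qed.

End Truncation.

(** * Choice of scale and numerical bounds *)

Section Bounds.
Local Open Scope nat_scope.

Lemma leq_exp_mono a b e f : 0 < b -> a <= b -> e <= f -> a ^ e <= b ^ f.
Proof.
move=> b_gt0 le_ab le_ef; apply: leq_trans (leq_pexp2l b_gt0 le_ef).
by case: e {le_ef} => // e; rewrite leq_exp2r.
Qed.

Definition scale l j := (2 * l) ^ ((3 * l) ^ j).

Lemma scale_gt1 l j : 0 < l -> 1 < scale l j.
Proof.
move=> l_gt0; have : 2 ^ 1 <= scale l j; last by [].
by apply: leq_exp_mono; rewrite ?expn_gt0; lia.
Qed.

(** With [K = scale l i], the later scale is at least [K ^ (3 * l)], hence at least [K ^ 2 * K ^ l],
    and [K ^ 2 >= 4]. *)
Lemma scale_gap l i j : 0 < l -> i < j ->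
  2 * ((scale l i).-1 + scale l i ^ l) <= scale l j.
Proof.
move=> l_gt0 lt_ij; have K_gt1 := scale_gt1 i l_gt0.
have : scale l i ^ (3 * l) <= scale l j.
  by rewrite /scale -expnM -expnSr leq_exp_mono ?leq_pexp2l; lia.
apply: leq_trans; move: K_gt1; set K := scale l i => K_gt1.
have : K ^ (2 + l) <= K ^ (3 * l) by rewrite leq_pexp2l; lia.
apply: leq_trans; rewrite expnD; have : K ^ 1 <= K ^ l by rewrite leq_pexp2l; lia.
have : 2 * 2 <= K ^ 2 by rewrite leq_mul.
rewrite expn1; nia.
Qed.

(* With [K_j = scale l j] and [C_j = K_j - 1 + K_j ^ l], the windows
   [d / C_j <= e < 2 d / K_j] are pairwise disjoint for [j < l], so fewer than [l]
   values [e] miss one of them. *)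
Lemma exists_scale l d (ds : seq nat) : size ds < l ->
  exists2 j, j < l & forall e, e \in ds ->
    2 * d <= scale l j * e \/ ((scale l j).-1 + scale l j ^ l) * e < d.
Proof.
move=> lt_ds_l; have l_gt0 : 0 < l by apply: leq_trans lt_ds_l.
pose bad j e := (scale l j * e < 2 * d) && (d <= ((scale l j).-1 + scale l j ^ l) * e).
have [/existsP[j good_j]|/existsPn all_bad] := boolP [exists j : 'I_l, ~~ has (bad j) ds].
  exists j => // e /(hasPn good_j); rewrite negb_and -leqNgt -ltnNge.
  by case/orP; [left | right].
have bad_lt (j : 'I_l) : find (bad j) ds < size ds.
  by rewrite -has_find; have := all_bad j; rewrite negbK.
have bad_inj : injective (fun j : 'I_l => Ordinal (bad_lt j)).
  have no_lt (i j : 'I_l) : i < j -> find (bad i) ds = find (bad j) ds -> False.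
    move=> lt_ij eq_f; have := all_bad i; have := all_bad j; rewrite !negbK.
    move=> /(nth_find 0); rewrite -eq_f => /andP[lt_j _] /(nth_find 0)/andP[_ le_i].
    have := scale_gap l_gt0 lt_ij; move: lt_j le_i.
    set e := nth _ _ _; set C := (_ + _); set K := scale l j; nia.
  move=> i j [eq_f]; apply: val_inj; case: (ltngtP i j) => // lt_ij.
    by case: (no_lt _ _ lt_ij eq_f).
  by case: (no_lt _ _ lt_ij (esym eq_f)).
by have := leq_card _ bad_inj; rewrite !card_ord leqNgt lt_ds_l.
Qed.

(** The left side counts the terms of the numerator in the inductive step. Every factor is at most
    [(4 * L) ^ X], so the sum is at most [(4 * L) ^ (2 * X + 1)]. *)
Lemma B1_step l j b : j < l.+1 -> b <= maxn 1 (B1 l) ->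
  b * l.+1 ^ (scale l.+1 j).-1 + scale l.+1 j ^ l.+1 * b <= B1 l.+1.
Proof.
set L := l.+1 => lt_j_L le_b; pose X := (2 * L) ^ ((3 * L) ^ L).
have X_gt0 : 0 < X by rewrite expn_gt0.
have {}le_b : b <= (4 * L) ^ X.
  apply: leq_trans le_b _; rewrite geq_max expn_gt0 /=.
  by apply: leq_exp_mono; rewrite ?leq_mul //; apply: leq_exp_mono => //;
    rewrite ?leq_mul //; apply: leq_exp_mono => //; rewrite ?leq_mul // addn1.
have le_l : L ^ (scale L j).-1 <= (4 * L) ^ X.
  apply: leq_exp_mono => //; first by rewrite leq_pmull.
  apply: leq_trans (leq_pred _) _; rewrite leq_pexp2l // leq_pexp2l //; lia.
have le_K : scale L j ^ L <= (4 * L) ^ X.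
  rewrite /scale -expnM; apply: leq_exp_mono; rewrite ?leq_mul //.
  apply: (@leq_trans ((3 * L) ^ L)); last by apply/ltnW/ltn_expl; lia.
  apply: leq_trans (_ : (3 * L) ^ j.+1 <= _); last by rewrite leq_pexp2l.
  by rewrite expnSr leq_mul // leq_pmull.
apply: (@leq_trans ((4 * L) ^ (X + X + 1))).
  rewrite addn1 expnS expnD; have := leq_mul le_b le_l; have := leq_mul le_K le_b.
  by set Y := (4 * L) ^ X; nia.
rewrite leq_pexp2l //; apply: (@leq_trans ((2 * L) ^ (2 + (3 * L) ^ L))).
  rewrite expnD -/X; have : 2 * 2 <= (2 * L) ^ 2 by rewrite leq_mul // leq_pmulr.
  nia.
rewrite leq_pexp2l // addn1 expnS; have : 0 < (3 * L) ^ L by rewrite expn_gt0.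
nia.
Qed.

End Bounds.

(** * Reversal, size and order at 0 *)

Section Reversal.
Variable F : fieldType.
Implicit Types (p q : {poly F}).

Lemma size_rev N p : (size (homog 1 'X N p) <= N.+1)%N.
Proof. by apply/leq_sizeP => j lt_N_j; rewrite coef_rev leqNgt lt_N_j. Qed.

Lemma revK N p : (size p <= N.+1)%N -> homog 1 'X N (homog 1 'X N p) = p.
Proof.
move=> szp; apply/polyP=> i; rewrite !coef_rev; case: leqP => [le_i_N|lt_N_i].
  by rewrite leq_subr subKn.
by rewrite nth_default // (leq_trans szp).
Qed.

Lemma dvdXn_rev M N p : (M + size p <= N.+1)%N -> 'X^M %| homog 1 'X N p.
Proof.
move=> szp; apply/dvdXnP => i lt_i_M; rewrite coef_rev; case: leqP => // le_i_N.
by rewrite nth_default // leq_subRL // -ltnS (leq_trans _ szp) // ltn_add2r.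
Qed.

End Reversal.

(** * Expansion of a composite at infinity and the induction *)

Section Composite.
Variable F : fieldType.
Hypothesis char0 : [pchar F] =i pred0.
Implicit Types (f g h p q : {poly F}).

Lemma depressed_approx g m : (0 < m)%N -> size g = m.+1 ->
  exists c, (size (g - lead_coef g *: ('X - c%:P) ^+ m)%R <= m.-1)%N.
Proof.
move=> m_gt0 szg; have m0 : m%:R != 0 :> F by rewrite natf_eq0 // -lt0n.
have lg0 : lead_coef g != 0 by rewrite lead_coef_eq0 -size_poly_eq0 szg.
(* The coefficient of degree [m.-1] in [('X - c%:P) ^+ m] is [- (c * m%:R)]; this shift matches it
   with that of [g]. *)
pose c := - g`_m.-1 / (lead_coef g * m%:R); exists c.
have Xc_monic : (('X - c%:P) ^+ m)`_m = 1.
  have /monicP := monic_exp m (monicXsubC c).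
  by rewrite lead_coefE size_exp_XsubC.
have Xc_sub : (('X - c%:P) ^+ m)`_m.-1 = - (c * m%:R).
  have := @coefPn_prod_XsubC _ (nseq m c).
  rewrite size_nseq -lt0n => /(_ m_gt0).
  by rewrite !big_nseq iter_mulr_1 iter_addr_0 mulr_natr.
apply/leq_sizeP => j le_j; rewrite coefB coefZ.
have [lt_m_j|] := ltnP m j.
  by rewrite !nth_default ?mulr0 ?subrr ?size_exp_XsubC ?szg.
rewrite leq_eqVlt => /predU1P[->|lt_j_m].
  by rewrite Xc_monic mulr1 lead_coefE szg subrr.
have -> : j = m.-1 by lia.
by rewrite Xc_sub /c mulrN opprK; field; rewrite lg0 m0.
Qed.

Lemma size_supported0 f : supported [:: 0%N] f -> (size f <= 1)%N.
Proof. by move=> sf; apply/leq_sizeP => -[|j] // _; apply: sf. Qed.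

(** The exponent [n >= d] is large at every scale, so it always falls into [R] and only [es] enters
    the pigeonhole. Thus [A] loses an exponent, which drives the induction. *)
Lemma split_scales l n d p es : (0 < d)%N -> (d <= n)%N -> (size es <= l)%N ->
    p`_0 = 1 -> supported [:: 0, n & es]%N p ->
  exists j A R, let K := scale l.+1 j in
    [/\ (j < l.+1)%N, p = A + R, A`_0 = 1 & R`_0 = 0] /\
    [/\ supported (0%N :: es) A, supported [:: 0, n & es]%N R,
        'X^(2 * d) %| R ^+ K & ((K.-1 + K ^ l.+1) * (size A).-1 < d)%N].
Proof.
move=> d_gt0 le_dn sz_es p0 sp.
have [j lt_j sep] := @exists_scale l.+1 d es sz_es; set K := scale l.+1 j in sep.
have K_gt1 : (1 < K)%N by apply: scale_gt1.
set C := (K.-1 + K ^ l.+1)%N in sep; have C_gt0 : (0 < C)%N by rewrite /C; lia.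
pose A := \poly_(i < size p) if (C * i < d)%N then p`_i else 0.
have coefA i : A`_i = if (C * i < d)%N then p`_i else 0.
  by rewrite coef_poly; case: ltnP => // /(nth_default 0)->; rewrite if_same.
have coefR i : (p - A)`_i = if (C * i < d)%N then 0 else p`_i.
  by rewrite coefB coefA; case: ifP; rewrite ?subrr ?subr0.
have A0 : A`_0 = 1 by rewrite coefA muln0 d_gt0.
exists j, A, (p - A) => /=; rewrite -/K -/C; split; first split=> //.
- by ring.
- by rewrite coefR muln0 d_gt0.
split.
- move=> i ies; rewrite coefA; case: ltnP => // lt_i; apply: sp.
  rewrite !inE in ies *; rewrite negb_or in ies; case/andP: ies => i0 ies.
  by rewrite (negPf i0) (negPf ies) orbF; apply: contraL lt_i => /eqP->; nia.
- by move=> i /sp pi; rewrite coefR pi if_same.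
(* The exponents of [R] are at least [2 * d / K] rounded up, which is [((2 * d).-1 %/ K).+1]. *)
- apply: (@dvdp_trans _ ('X^(((2 * d).-1 %/ K).+1) ^+ K)).
    rewrite -exprM dvdp_exp2l //.
    by rewrite -[(2 * d)%N]prednK ?muln_gt0 ?d_gt0 // ltn_ceil // ltnW.
  apply: dvdp_exp2r; apply/dvdXnP => i; rewrite ltnS leq_divRL ?(ltnW K_gt1) // => lt_i.
  rewrite coefR; case: ifP => // /negbT lt_di.
  have [|/sp//] := boolP (i \in [:: 0, n & es]%N); rewrite !inE.
  move=> /or3P[/eqP i0|/eqP i_n|/sep[le_i|lt_i']]; last by rewrite lt_i' in lt_di.
  - by rewrite i0 muln0 d_gt0 in lt_di.
  - by move: lt_i; rewrite i_n; nia.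
  - by move: lt_i; rewrite mulnC; lia.
have: A`_(size A).-1 != 0.
  by rewrite -lead_coefE lead_coef_eq0; apply: contra_eq_neq A0 => ->;
     rewrite coef0 eq_sym oner_eq0.
by rewrite coefA; case: ltnP => //; rewrite eqxx.
Qed.

Lemma size_comp_gt1 f g h : (1 < size f)%N -> f = g \Po h ->
  (1 < size g)%N /\ (1 < size h)%N.
Proof.
move=> szf def_f; have := size_comp_poly g h; rewrite -def_f => szE.
have : (0 < (size g).-1 * (size h).-1)%N by rewrite -szE -subn1 subn_gt0.
by rewrite muln_gt0 -!subn1 !subn_gt0 => /andP.
Qed.

(** [H] is the reversal of [h - c%:P], normalized to constant term 1. Depressing [g] leaves a
    remainder [q] of degree at most [m - 2], so [q \Po h] has degree at most [m * d - 2 * d] and its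
    reversal is divisible by ['X^(2 * d)]. *)
Lemma reversed_root f g h (m := (size g).-1) (d := (size h).-1) :
    (1 < size f)%N -> f = g \Po h ->
  exists c H, [/\ h = c%:P + lead_coef h *: homog 1 'X d H, (size H <= d.+1)%N, H`_0 = 1
    & 'X^(2 * d) %| H ^+ m - (lead_coef f)^-1 *: homog 1 'X (m * d) f].
Proof.
move=> szf def_f; have [szg szh] := size_comp_gt1 szf def_f.
have m_gt0 : (0 < m)%N by rewrite /m -subn1 subn_gt0.
have d_gt0 : (0 < d)%N by rewrite /d -subn1 subn_gt0.
have [c szq] := depressed_approx m_gt0 (esym (prednK (ltnW szg))).
set q := g - _ in szq.
have lh0 : lead_coef h != 0 by rewrite lead_coef_eq0 -size_poly_gt0 ltnW.
have lg0 : lead_coef g != 0 by rewrite lead_coef_eq0 -size_poly_gt0 ltnW.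
have lf : lead_coef f = lead_coef g * lead_coef h ^+ m by rewrite def_f lead_coef_comp.
have sz1 : (size (h - c%:P)%R <= d.+1)%N.
  rewrite (leq_trans (size_polyD _ _)) // size_polyN geq_max /d prednK ?(ltnW szh) // leqnn.
  by rewrite (leq_trans (size_polyC_leq1 _)) // ltnW.
have f_approx : f = lead_coef g *: (h - c%:P) ^+ m + (q \Po h).
  rewrite /q comp_polyB comp_polyZ -[('X - c%:P) ^+ m]comp_Xn_poly -comp_polyA.
  by rewrite comp_Xn_poly comp_polyB comp_polyX comp_polyC addrC subrK.
exists c, ((lead_coef h)^-1 *: homog 1 'X d (h - c%:P)); split.
- by rewrite homogZ revK // scalerA divff // scale1r addrC subrK.
- exact: leq_trans (size_scale_leq _ _) (size_rev _ _).
- rewrite coefZ coef_rev subn0 coefB coefC gtn_eqF // subr0.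
  by rewrite -lead_coefE mulVf.
rewrite exprZn -homogX // f_approx homogD homogZ scalerDr scalerA.
rewrite -f_approx lf invfM mulrAC mulVf // mul1r exprVn opprD addrA subrr add0r dvdpNr.
rewrite -mul_polyC dvdp_mull //; have [->|q0] := eqVneq q 0.
  by rewrite comp_poly0 homog0 dvdp0.
apply: dvdXn_rev; have := size_comp_poly q h; rewrite -/d.
move: q0; rewrite -size_poly_gt0; case: (size q) szq => // s szq _ /= sz_qh.
apply: (@leq_trans (2 * d + (s * d).+1)); first by rewrite leq_add2l -sz_qh leqSpred.
by rewrite addnS ltnS -mulnDl leq_mul2r; apply/orP; right; lia.
Qed.

Lemma nterms_size p : (nterms p <= size p)%N.
Proof. exact: count_size. Qed.

Lemma composite_ratio l f g h es :
    (1 < size f)%N -> f = g \Po h -> (size es <= l)%N -> supported (0%N :: es) f ->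
  exists P Q : {poly F},
    [/\ Q != 0, (nterms P <= B1 l)%N, (nterms Q <= B1 l)%N & Q * h = P].
Proof.
elim: l f g h es => [|l IHl] f g h es szf def_f sz_es sf.
  by case: es sz_es sf => // _ /size_supported0; rewrite leqNgt szf.
have [szg szh] := size_comp_gt1 szf def_f.
have [c [H [def_h szH H0 H_root]]] := reversed_root szf def_f.
set m := (size g).-1 in H_root; set d := (size h).-1 in def_h szH H_root.
have m_gt0 : (0 < m)%N by rewrite /m -subn1 subn_gt0.
have d_gt0 : (0 < d)%N by rewrite /d -subn1 subn_gt0.
pose n := (m * d)%N; rewrite -/n in H_root.
have szfE : (size f).-1 = n by rewrite def_f size_comp_poly.
have le_dn : (d <= n)%N by rewrite leq_pmull.
have fn0 : f`_n != 0 by rewrite -szfE -lead_coefE lead_coef_eq0 -size_poly_gt0 ltnW.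
have n_es : n \in es.
  have : n \in 0%N :: es by apply: contraR fn0 => /sf->.
  by rewrite inE => /predU1P[n0|//]; move: d_gt0; rewrite ltnNge -n0 le_dn.
(* Reversal exchanges the exponents [0] and [n]; the other ones form [ds], one fewer than [es]. *)
pose ds := [seq (n - e)%N | e <- rem n es].
have sz_ds : (size ds <= l)%N.
  by rewrite size_map size_rem // -ltnS (leq_trans _ sz_es) // prednK //; case: (es) n_es.
set p := _ *: _ in H_root.
have p0 : p`_0 = 1.
  by rewrite coefZ coef_rev subn0 lead_coefE szfE mulVf.
have sp : supported [:: 0, n & ds]%N p.
  move=> i ids; rewrite coefZ (supported_rev (N := n) sf) ?mulr0 //.
  apply: contra ids => /mapP[e e_es ->].
  move: e_es; rewrite inE => /predU1P[->|e_es]; first by rewrite subn0 !inE eqxx orbT.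
  have [->|ne] := eqVneq e n; first by rewrite subnn inE.
  by rewrite !inE (map_f (subn n)) ?orbT // rem_mem.
have [j [A [R []]]] := split_scales d_gt0 le_dn sz_ds p0 sp.
set K := scale _ _; set k := K.-1 => -[lt_j def_p A0 R0] [sA sR R_small lt_d].
have K_gt1 : (1 < K)%N by apply: scale_gt1.
have KE : K = k.+1 by rewrite prednK // ltnW.
have sA' : supported [:: 0, n & ds]%N A.
  by move=> i; rewrite !inE !negb_or => /and3P[i0 _ ids]; rewrite sA // inE negb_or i0.
have sz_nds : (size (n :: ds) <= l.+1)%N by [].
have le_pow : (K ^ size (n :: ds) <= K ^ l.+1)%N by rewrite leq_pexp2l // ltnW.
have lt_d' : ((k + k.+1 ^ size (n :: ds)) * (size A).-1 < d)%N.
  by apply: leq_ltn_trans lt_d; rewrite leq_mul2r leq_add2l -KE le_pow orbT.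
rewrite def_p in H_root; rewrite KE in R_small.
have k_gt0 : (0 < k)%N by rewrite /k; lia.
have [S [B [BA AH sS]]] :=
  near_root_factor char0 m_gt0 k_gt0 A0 R0 H0 sA' sR H_root R_small szH lt_d'.
(* If [A] is constant then so is [B], and one term suffices; the maximum is there since [B1 0 = 0].
   Otherwise induction applies to the composite ['X^m \Po B]. *)
have [P0 [Q0 [Q0nz le_P0 le_Q0 QB]]] : exists P Q : {poly F},
    [/\ Q != 0, (nterms P <= maxn 1 (B1 l))%N, (nterms Q <= maxn 1 (B1 l))%N & Q * B = P].
  have [szA|szA] := leqP (size A) 1.
    exists B, 1; rewrite oner_neq0 nterms1 leq_maxl mul1r; split=> //.
    rewrite leq_max (leq_trans (nterms_size B)) //.
    have /eqP : ((size A).-1 = m * (size B).-1)%N.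
      by rewrite -BA -comp_Xn_poly size_comp_poly size_polyXn.
    rewrite -[(size A).-1]subn1 (eqP (_ : size A - 1 == 0)%N) ?subn_eq0 //.
    by rewrite eq_sym muln_eq0 eqn0Ngt m_gt0 -[(size B).-1]subn1 subn_eq0.
  have AB : A = 'X^m \Po B by rewrite comp_Xn_poly.
  have [P [Q [Qnz le_P le_Q QBP]]] := IHl _ _ _ _ szA AB sz_ds sA.
  by exists P, Q; rewrite Qnz !leq_max le_P le_Q !orbT.
have A_nz : A != 0 by apply: contra_eq_neq A0 => ->; rewrite coef0 eq_sym oner_eq0.
have nA : (nterms A <= l.+1)%N by apply: leq_trans (nterms_supported sA) _.
have nS : (nterms S <= K ^ l.+1)%N.
  by apply: leq_trans (nterms_supported sS) _; rewrite size_sumset -KE.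
(* Clearing denominators gives [H * W = S * P0]; reversing this identity in degrees [d] and [N]
   expresses [h] through [V] and [W']. *)
pose W := Q0 * A ^+ k; pose N := size W.
have HW : H * W = S * P0 by rewrite /W mulrCA [H * _]mulrC AH mulrCA QB.
have nW : (nterms W <= maxn 1 (B1 l) * l.+1 ^ k)%N.
  apply: leq_trans (ntermsM _ _) (leq_mul le_Q0 _).
  by apply: leq_trans (ntermsX _ _) _; case: (k) => // k'; rewrite leq_exp2r.
have nV : (nterms (S * P0) <= K ^ l.+1 * maxn 1 (B1 l))%N.
  exact: leq_trans (ntermsM _ _) (leq_mul nS le_P0).
have bound := B1_step lt_j (leqnn (maxn 1 (B1 l))).
rewrite -/K -/k in bound.
have revHW : homog 1 'X (d + N) (S * P0) = homog 1 'X d H * homog 1 'X N W.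
  by rewrite -HW homogM.
set W' := homog 1 'X N W in revHW; set V := homog _ _ _ (S * P0) in revHW.
exists (c *: W' + lead_coef h *: V), W'; split.
(* Reversal is an involution on polynomials of degree at most [N], so [W'] vanishes only if [W]
   does. *)
- apply: contra_neq (_ : W != 0); last by rewrite mulf_neq0 ?expf_neq0.
  move=> W'0; rewrite -(revK (leqnSn _ : (size W <= N.+1)%N)) -/W' W'0.
  exact: homog0.
- apply: leq_trans bound; apply: leq_trans (ntermsD _ _) (leq_add _ _).
    exact: leq_trans (ntermsZ _ _) (leq_trans (nterms_rev _ _) nW).
  exact: leq_trans (ntermsZ _ _) (leq_trans (nterms_rev _ _) nV).
- apply: leq_trans bound; apply: leq_trans (leq_addr _ _).
  exact: leq_trans (nterms_rev _ _) nW.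
by rewrite {1}def_h revHW -!mul_polyC; ring.
Qed.

End Composite.

(** * The complex case, in the fraction field *)

Theorem theorem1 (R : realType) (l : nat) (f g h : {poly R[i]})
    (a0 : R[i]) (a : 'I_l -> R[i]) (n : 'I_l -> nat)
    (hl : (1 <= l)%N)
    (hf : (1 < size f)%N) (hg : (1 < size g)%N) (hh : (1 < size h)%N)
    (hfgh : f = g \Po h)
    (hn0 : forall i : 'I_l, (0 < n i)%N)
    (hn : forall i j : 'I_l, (i < j)%N -> (n i < n j)%N)
    (hfl : f = a0%:P + \sum_(i < l) a i *: 'X^(n i)) :
  exists P Q : {poly R[i]},
    [/\ Q != 0,
        (nterms P <= B1 l)%N,
        (nterms Q <= B1 l)%N
      & FracField.tofrac h = FracField.tofrac P / FracField.tofrac Q].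
Proof.
have sf : supported (0%N :: [seq n i | i <- enum 'I_l]) f.
  move=> e; rewrite inE negb_or => /andP[e0 e_n]; rewrite hfl coefD coefC (negPf e0) add0r.
  rewrite coef_sum big1 // => i _; rewrite coefZ coefXn; case: eqP => [e_ni|_].
    by rewrite e_ni map_f ?mem_enum in e_n.
  by rewrite mulr0.
have sz_n : (size [seq n i | i <- enum 'I_l] <= l)%N by rewrite size_map size_enum_ord.
have [P [Q [Q0 le_P le_Q QhP]]] := composite_ratio (pchar_num _) hf hfgh sz_n sf.
exists P, Q; split=> //; rewrite -QhP tofracM mulrC mulKf //.
by rewrite tofrac_eq0.
Qed.
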